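(* Let $f:\mathbb{R}^d\to\mathbb{R}$ be twice differentiable, $L$-smooth, $\sigma$-strongly convex, and with $\gamma$-Lipschitz Hessian. Let $\hat\mu_*$ be the $\mu$-part of the minimizer of $Q_\alpha(\mu,\Sigma)$ over $\mu\in\mathbb{R}^d$ under the constraint $\Sigma\in\mathcal{S}$, and let $\mu_*$ be the minimizer of $f$. Then $$f(\hat\mu_* )-f(\mu_* )\le\frac{dL\alpha^2}{\tau}+\frac{\gamma\alpha^3(d^2+2d)^{3/4}}{3\tau^{3/2}}+\frac{d\alpha^2}{2}\left(\tau^{-1}-\zeta^{-1}\right)$$ and $$\|\mu_*-\hat\mu_*\|^2\le\frac{2dL\alpha^2}{\sigma\tau}+\frac{2\gamma\alpha^3(d^2+2d)^{3/4}}{3\sigma\tau^{3/2}}+\frac{d\alpha^2}{\sigma}\left(\tau^{-1}-\zeta^{-1}\right).$$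
   Context: Fix constants $\alpha>0$ and $0<\tau\le\zeta$. For $\mu\in\mathbb{R}^d$ and symmetric positive definite $\Sigma$, define $$Q_\alpha(\mu,\Sigma)=\mathbb{E}_{u\sim N(0,I_d)}\left[f(\mu+\alpha\Sigma^{1/2}u)\right]-\frac{\alpha^2}{2}\log\det\Sigma .$$ $\mathcal{S}=\{\Sigma \text{ symmetric } d\times d:\ \zeta^{-1}I\preceq\Sigma\preceq\tau^{-1}I\}$. $f$ is $L$-smooth if $\|\nabla f(\mu_1)-\nabla f(\mu_2)\|\le L\|\mu_1-\mu_2\|$; $\sigma$-strongly convex if $f(\mu_1)-f(\mu_2)\ge\langle\nabla f(\mu_2),\mu_1-\mu_2\rangle+\frac{\sigma}{2}\|\mu_1-\mu_2\|^2$; and has $\gamma$-Lipschitz Hessian if $\|\nabla^2 f(\mu_1)-\nabla^2 f(\mu_2)\|\le\gamma\|\mu_1-\mu_2\|$; each for all $\mu_1,\mu_2\in\mathbb{R}^d$. Here $\|\cdot\|$ is the Euclidean norm on vectors and the Frobenius norm on matrices. *)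

(* Defs.v *)
From HB Require Import structures.
From mathcomp Require Import all_boot all_order all_algebra.
From mathcomp Require Import all_classical all_reals all_analysis.

Set Implicit Arguments.
Unset Strict Implicit.
Unset Printing Implicit Defensive.

Import Order.TTheory GRing.Theory Num.Theory.
Import numFieldNormedType.Exports.

Local Open Scope classical_set_scope.
Local Open Scope ring_scope.

(* The norm `|_| that the library puts on 'M[R]_(m, n) is the max norm, hence
   this definition: Euclidean norm on columns, Frobenius norm on matrices. *)
Definition norm2 (R : realType) (m n : nat) (A : 'M[R]_(m, n)) : R :=
  Num.sqrt (\sum_(i < m) \sum_(j < n) A i j ^+ 2).

Definition dotv (R : realType) (d : nat) (u v : 'cV[R]_d) : R :=
  \sum_(i < d) u i 0 * v i 0.

Definition grad (R : realType) (d : nat) (f : 'cV[R]_d -> R) (x : 'cV[R]_d) :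
    'cV[R]_d :=
  \col_(i < d) 'D_(delta_mx i 0) f x.

Definition hessian (R : realType) (d : nat) (f : 'cV[R]_d -> R)
    (x : 'cV[R]_d) : 'M[R]_d :=
  \matrix_(i < d, j < d) 'D_(delta_mx i 0) ('D_(delta_mx j 0) f) x.

Definition twice_differentiable (R : realType) (d : nat)
    (f : 'cV[R]_d -> R) : Prop :=
  (forall x, differentiable f x) /\ (forall x, differentiable (grad f) x).

Definition smooth (R : realType) (d : nat) (L : R) (f : 'cV[R]_d -> R) : Prop :=
  forall x y, norm2 (grad f x - grad f y) <= L * norm2 (x - y).

Definition strongly_convex (R : realType) (d : nat) (sigma : R)
    (f : 'cV[R]_d -> R) : Prop :=
  forall x y,
    dotv (grad f y) (x - y) + sigma / 2 * norm2 (x - y) ^+ 2 <= f x - f y.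

Definition lipschitz_hessian (R : realType) (d : nat) (gamma : R)
    (f : 'cV[R]_d -> R) : Prop :=
  forall x y, norm2 (hessian f x - hessian f y) <= gamma * norm2 (x - y).

Definition psdmx (R : realType) (d : nat) (A : 'M[R]_d) : Prop :=
  A^T = A /\ forall v : 'cV[R]_d, 0 <= dotv v (A *m v).

Definition loewner_le (R : realType) (d : nat) (A B : 'M[R]_d) : Prop :=
  psdmx (B - A).

(* A positive semidefinite A has exactly one positive semidefinite square root;
   the value at any other A is irrelevant. *)
Definition sqrtmx (R : realType) (d : nat) (A : 'M[R]_d) : 'M[R]_d :=
  xget 0 [set B | psdmx B /\ B *m B = A].

Section standard_gaussian.
Context {R : realType}.

Definition consT (d : nat)
    (p : measurableTypeR R * d.-tuple (measurableTypeR R)) :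
    d.+1.-tuple (measurableTypeR R) :=
  [tuple of p.1 :: p.2].

Lemma measurable_consT d : measurable_fun [set: _] (@consT d).
Proof. by apply: measurable_cons; [exact: measurable_fst|exact: measurable_snd]. Qed.

HB.instance Definition _ d :=
  isMeasurableFun.Build _ _ _ _ (@consT d) (@measurable_consT d).

(* N(0, I_d) is the d-fold product of N(0, 1).  It lives on d.-tuple R because
   that type, unlike 'cV[R]_d, carries the product sigma-algebra. *)
Fixpoint std_gaussian (d : nat) :
    probability (d.-tuple (measurableTypeR R)) R :=
  if d is d'.+1
  then distribution (normal_prob (0 : R) 1 \x std_gaussian d')%E (@consT d')
  else \d_[tuple].

Lemma std_gaussian_box d (A : 'I_d -> set (measurableTypeR R)) :
  (forall i, measurable (A i)) ->
  std_gaussian d [set t | forall i, A i (tnth t i)] =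
    (\prod_(i < d) normal_prob (0 : R) 1 (A i))%E.
Proof.
elim: d A => [|d IH] A mA.
  rewrite big_ord0 (_ : [set t | _] = setT) ?probability_setT//.
  by apply/seteqP; split => // t _ [].
have mbox : measurable [set t : d.-tuple (measurableTypeR R) |
    forall i, A (lift ord0 i) (tnth t i)].
  rewrite (_ : mkset _ = \big[setI/setT]_(i < d)
      ((fun t : d.-tuple (measurableTypeR R) => tnth t i) @^-1`
         A (lift ord0 i))).
    apply: bigsetI_measurable => i _; rewrite -[X in measurable X]setTI.
    exact: measurable_tnth.
  apply/seteqP; split => [t /= tA|t /= tA i].
    by elim/big_ind : _ => // i _; exact: tA.
  by move: tA; rewrite (bigD1 i)//= => -[].
rewrite big_ord_recl -IH//= /distribution /pushforward /=.
rewrite -product_measure1E//; congr (_ _).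
apply/seteqP; split => -[x t] /= xt.
  by split => [|i]; [have := xt ord0|have := xt (lift ord0 i)];
    rewrite /consT ?tnth0 ?tnthS.
move=> i; case: (unliftP ord0 i) => [j ->|->]; rewrite /consT ?tnth0 ?tnthS.
  exact: xt.2.
exact: xt.1.
Qed.

End standard_gaussian.

Definition col_of_tuple (R : realType) (d : nat) (t : d.-tuple R) : 'cV[R]_d :=
  \col_(i < d) tnth t i.

(* Extended-real because 'E is; finite whenever f is measurable with at most
   quadratic growth. *)
Definition Qfun (R : realType) (d : nat) (f : 'cV[R]_d -> R) (alpha : R)
    (mu : 'cV[R]_d) (Sigma : 'M[R]_d) : \bar R :=
  ('E_(std_gaussian d)
      [(fun u => f (mu + alpha *: (sqrtmx Sigma *m col_of_tuple u)))%R]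
   - (alpha ^+ 2 / 2 * ln (\det Sigma))%:E)%E.

Definition Sset (R : realType) (d : nat) (tau zeta : R) : set 'M[R]_d :=
  [set Sigma | [/\ Sigma^T = Sigma,
                   loewner_le (zeta^-1)%:M Sigma &
                   loewner_le Sigma (tau^-1)%:M]].

(* Main.v *)
(* Compare the minimizer (mu_hat, Sigma_hat) with (mu_star, Sigma_hat) only: the
   log-determinants cancel.  Writing S for the square root of Sigma_hat, the
   first-order convexity inequality at mu_hat and E u = 0 give
   E f(mu_hat + alpha S u) >= f(mu_hat).  As grad f mu_star = 0, convexity at
   the other endpoint and smoothness give f y - f mu_star <= L |y - mu_star|^2,
   so |S u|^2 <= |u|^2 / tau and E |u|^2 <= d yield
   E f(mu_star + alpha S u) <= f(mu_star) + d L alpha^2 / tau.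
   The other two terms of the bound are nonnegative. *)
Require Import Defs.
From mathcomp Require Import all_boot all_order all_algebra.
From mathcomp Require Import all_classical all_reals all_analysis.
From mathcomp Require Import measurable_realfun ring lra.
Import Order.TTheory GRing.Theory Num.Theory.
Import numFieldNormedType.Exports.
Local Open Scope classical_set_scope.
Local Open Scope ring_scope.

(* No measurability: the integral of a nonnegative function is a supremum over
   the simple functions below it. *)
Lemma le_integral_pointwise dT (T : measurableType dT) (R : realType)
    (mu : {measure set T -> \bar R}) (f g : T -> \bar R) :
  (forall x, (f x <= g x)%E) -> (\int[mu]_x f x <= \int[mu]_x g x)%E.
Proof.
move=> fg.
have ge0_le (u v : T -> \bar R) : (forall x, (0 <= u x)%E) ->
    (forall x, (u x <= v x)%E) -> (\int[mu]_x u x <= \int[mu]_x v x)%E.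
  move=> u0 uv; have v0 x : (0 <= v x)%E by exact: le_trans (u0 x) (uv x).
  rewrite !ge0_integralTE//; apply: ereal_sup_le => _ [h /= hu <-].
  by exists h => // x; exact: le_trans (hu x) (uv x).
rewrite integralE [leRHS]integralE; apply: leeB.
  apply: ge0_le => x; first exact: funepos_ge0.
  by apply: (@funepos_le _ _ setT); rewrite ?inE.
apply: ge0_le => x; first exact: funeneg_ge0.
by apply: (@funeneg_le _ _ setT); rewrite ?inE.
Qed.

(** * Moments of the one-dimensional standard normal law *)

(** The Radon-Nikodym derivative of [normal_prob m s] and [normal_pdf m s] have the same integral
    over every measurable set, so they agree almost everywhere and one may replace the other in the
    change of variables. *)
Lemma ge0_integral_normal_prob (R : realType) (m s : R) (g : R -> \bar R) :
  measurable_fun setT g -> (forall x, (0 <= g x)%E) ->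
  (\int[normal_prob m s]_x g x =
   \int[lebesgue_measure]_x (g x * (normal_pdf m s x)%:E))%E.
Proof.
move=> mg g0.
have dom := normal_prob_dominates m s.
rewrite -(Radon_Nikodym_SigmaFinite.change_of_variables dom)//.
set h := Radon_Nikodym_SigmaFinite.f _ _.
have ih : lebesgue_measure.-integrable setT h
  by exact: Radon_Nikodym_SigmaFinite.f_integrable.
have mh : measurable_fun setT h by exact: measurable_int ih.
have mp : measurable_fun setT (fun x => (normal_pdf m s x)%:E).
  by apply/measurable_EFinP; exact: measurable_normal_pdf.
apply: ge0_ae_eq_integral => //.
- exact: emeasurable_funM.
- exact: emeasurable_funM.
- by move=> x _; rewrite mule_ge0// Radon_Nikodym_SigmaFinite.f_ge0.
- by move=> x _; rewrite mule_ge0// lee_fin normal_pdf_ge0.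
apply: ae_eqe_mul2l; apply: integral_ae_eq => // A _ mA.
by rewrite -Radon_Nikodym_SigmaFinite.f_integral.
Qed.

(** The ratio is the density of the normal law of mean [m] and variance [s ^+ 2] relative to the
    standard one. Lower bounds on it, obtained from [1 + z <= expR z], integrate to bounds on
    moments. *)
Lemma integral_normal_pdf_ratio (R : realType) (m s : R) : s != 0 ->
  (\int[normal_prob (0 : R) 1]_x (normal_pdf m s x / normal_pdf 0 1 x)%:E = 1)%E.
Proof.
move=> s0; rewrite ge0_integral_normal_prob; last 2 first.
- apply/measurable_EFinP/measurable_funM; first exact: measurable_normal_pdf.
  rewrite (_ : (fun x => (normal_pdf 0 1 x)^-1) =
      (fun x : R => (normal_peak 1)^-1 * expR (x ^+ 2 / 2))).
    apply: measurable_funM => //; apply: measurableT_comp => //.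
    by apply: measurable_funM => //; exact: measurable_funX.
  apply/funext => x; rewrite normal_pdfE ?oner_neq0// invfM /normal_fun.
  by rewrite -expRN subr0 expr1n mulNr opprK.
- by move=> x; rewrite lee_fin divr_ge0// normal_pdf_ge0.
rewrite -[RHS](integral_normal_pdf m s); apply: eq_integral => x _.
rewrite -EFinM divfK// normal_pdfE ?oner_neq0// mulf_neq0//.
  by rewrite gt_eqF// normal_peak_gt0// oner_neq0.
by rewrite gt_eqF// expR_gt0.
Qed.

Lemma normal_pdf_ratioE (R : realType) (m s x : R) : 0 < s ->
  normal_pdf m s x / normal_pdf 0 1 x =
  s^-1 * expR (x ^+ 2 / 2 - (x - m) ^+ 2 / (s ^+ 2 * 2)).
Proof.
move=> s0; rewrite !normal_pdfE ?oner_neq0 ?gt_eqF// -mulf_div; congr (_ * _).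
  rewrite /normal_peak expr1n mul1r -mulrnAr sqrtrM ?sqr_ge0//.
  rewrite sqrtr_sqr gtr0_norm// invfM mulfK// invr_eq0.
  by rewrite gt_eqF// sqrtr_gt0 mulrn_wgt0// pi_gt0.
rewrite /normal_fun -expRN -expRD; congr expR.
by rewrite subr0 expr1n -(mulr_natr (s ^+ 2)) !mulNr opprK addrC.
Qed.

(* [pdf_(0,s) / pdf_(0,1) >= (1 + (1 - s^-2) x^2 / 2) / s] integrates to a bound
   on the second moment that tends to 1 as [s] decreases to 1. *)
Lemma normal_second_moment_le1 (R : realType) :
  (\int[normal_prob (0 : R) 1]_x (x ^+ 2)%:E <= 1)%E.
Proof.
set E2 := (X in (X <= _)%E).
(* With [c] as below, integration gives [1 + c * E2 <= s], and [(s - 1) / c] simplifies to the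
   stated bound. *)
have E2_le (s : R) : 1 < s -> (E2 <= ((2 * s ^+ 2) / (s + 1))%:E)%E.
  move=> s1; have s0 : 0 < s by lra.
  (* For [m = 0] the exponent in [normal_pdf_ratioE] is exactly [c * x ^+ 2]. *)
  pose c := (1 - (s ^+ 2)^-1) / 2.
  have c0 : 0 < c by rewrite divr_gt0// subr_gt0 invf_lt1 ?exprn_gt0// expr_gt1// ltW.
  have le1 : (s^-1%:E * (1 + c%:E * E2) <= 1)%E.
    rewrite -[leRHS](@integral_normal_pdf_ratio R 0 s) ?gt_eqF//.
    have -> : (s^-1%:E * (1 + c%:E * E2) =
        \int[normal_prob (0 : R) 1]_x (s^-1 * (1 + c * x ^+ 2))%:E)%E.
      under eq_integral do rewrite EFinM EFinD EFinM.
      have mx : measurable_fun setT (fun x : R => (x ^+ 2)%:E).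
        by apply/measurable_EFinP; exact: measurable_funX.
      rewrite ge0_integralZl//; last 3 first.
      - by apply: emeasurable_funD => //; apply: measurable_funeM.
      - by move=> x _; rewrite adde_ge0// mule_ge0// lee_fin ?sqr_ge0 ?ltW.
      - by rewrite lee_fin invr_ge0 ltW.
      rewrite ge0_integralD//; last 2 first.
      - by move=> x _; rewrite mule_ge0// lee_fin ?sqr_ge0 ?ltW.
      - by apply: measurable_funeM.
      rewrite integral_cst// mul1e ge0_integralZl//; last 2 first.
      - by move=> x _; rewrite lee_fin sqr_ge0.
      - by rewrite lee_fin ltW.
      by rewrite [X in _ = (_ * (X + _))%E]probability_setT.
    apply: le_integral_pointwise => x; rewrite lee_fin normal_pdf_ratioE//.
    rewrite ler_pM2l ?invr_gt0//; apply: le_trans (expR_ge1Dx _).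
    rewrite lerD2l subr0 /c le_eqVlt; apply/orP; left; apply/eqP.
    by field; rewrite gt_eqF.
  have E20 : (0 <= E2)%E by apply: integral_ge0 => x _; rewrite lee_fin sqr_ge0.
  move: le1 E20; case: E2 => [r| |]//=.
    rewrite !lee_fin mulrC ler_pdivrMr// mul1r => h _.
    rewrite ler_pdivlMr; last by lra.
    have cr : c * r <= s - 1 by lra.
    have s10 : 0 < s - 1 by lra.
    have s20 : 0 < 2 * s ^+ 2 by rewrite mulr_gt0// exprn_gt0.
    rewrite -(ler_pM2r s10).
    have -> : r * (s + 1) * (s - 1) = c * r * (2 * s ^+ 2).
      by rewrite /c; field; rewrite gt_eqF.
    by rewrite [leRHS]mulrC ler_pM2r.
  (* An infinite [E2] would make the left side of [le1] infinite. *)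
  by rewrite mulry gtr0_sg// mul1e addey// mulry gtr0_sg ?invr_gt0// mul1e.
have E20 : (0 <= E2)%E by apply: integral_ge0 => x _; rewrite lee_fin sqr_ge0.
move: E2_le E20; case: E2 => [r| |]//= r_le.
- move=> _; rewrite lee_fin; apply/ler_addgt0Pr => e e0.
  (* For [s = 1 + e / 4] one has [2 * s ^+ 2 <= (1 + e) * (s + 1)], whatever the size of [e > 0]. *)
  have /r_le : 1 < 1 + e / 4 by lra.
  rewrite lee_fin => /le_trans; apply; rewrite ler_pdivrMr; last by lra.
  by nra.
- by have /r_le := ltr1n R 2.
Qed.

(** The square of [|x| - 1] is nonnegative, so [|x| <= 1 + x ^+ 2], and the second moment is
    finite. *)
Lemma integrable_normal_id (R : realType) :
  (normal_prob (0 : R) 1).-integrable setT (fun x : R => x%:E).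
Proof.
have mid : measurable_fun setT (fun x : R => x%:E) by exact/measurable_EFinP.
apply/integrableP; split => //.
have mx : measurable_fun setT (fun x : R => (x ^+ 2)%:E).
  by apply/measurable_EFinP; exact: measurable_funX.
apply: (@le_lt_trans _ _
    (\int[normal_prob (0 : R) 1]_x (1 + (x ^+ 2)%:E))%E).
  apply: le_integral_pointwise => x; rewrite abse_EFin -EFinD lee_fin.
  rewrite -real_normK ?num_real//; have := sqr_ge0 (`|x| - 1).
  by have := normr_ge0 x; nra.
rewrite ge0_integralD//; last by move=> x _; rewrite lee_fin sqr_ge0.
rewrite integral_cst// mul1e [X in (X + _)%E]probability_setT.
by rewrite lte_add_pinfty ?ltry// (le_lt_trans (normal_second_moment_le1 R)) ?ltry.
Qed.

(* [pdf_(t,1) / pdf_(0,1) >= 1 + t x - t^2 / 2] gives [t E x <= t^2 / 2] for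
   all [t] of both signs. *)
Lemma normal_mean0 (R : realType) :
  (\int[normal_prob (0 : R) 1]_x x%:E = 0)%E.
Proof.
have ix := integrable_normal_id R.
have := integrable_fin_num measurableT ix.
set E1 := integral _ _ _ => /fineK E1E; move: E1E => /esym E1E.
have E1_le (t : R) : t * fine E1 <= t ^+ 2 / 2.
  have : (\int[normal_prob (0 : R) 1]_x ((1 - t ^+ 2 / 2)%:E + t%:E * x%:E) <= 1)%E.
    rewrite -[leRHS](@integral_normal_pdf_ratio R t 1) ?oner_neq0//.
    apply: le_integral_pointwise => x; rewrite -EFinM -EFinD lee_fin.
    rewrite normal_pdf_ratioE// invr1 mul1r expr1n mul1r.
    apply: le_trans (expR_ge1Dx _); rewrite le_eqVlt; apply/orP; left; apply/eqP.
    by field.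
  rewrite integralD//; last 2 first.
  - exact: finite_measure_integrable_cst.
  - exact: integrableZl.
  rewrite integralZl// integral_cst// [X in (_ * X)%E]probability_setT mule1.
  by rewrite -/E1 E1E -EFinM -EFinD lee_fin; lra.
rewrite E1E; congr EFin; apply/eqP; rewrite eq_le; apply/andP; split.
  (* Dividing by [e] at [t = e] bounds the mean above by [e / 2]; [t = - e] gives the opposite
     bound. *)
  apply/ler_addgt0Pr => e e0; have := E1_le e.
  by rewrite expr2 -mulrA ler_pM2l//; lra.
rewrite -lerN2 oppr0; apply/ler_addgt0Pr => e e0; have := E1_le (- e).
by rewrite sqrrN mulNr -mulrN expr2 -mulrA ler_pM2l//; lra.
Qed.

(** * Marginals and moments of the [d]-dimensional Gaussian *)

(** A cylinder is a box whose other sides are the whole line, each of mass 1. This reduces integrals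
    in one coordinate to the one-dimensional law. *)
Lemma std_gaussian_tnth (R : realType) (d : nat) (i : 'I_d)
    (A : set (measurableTypeR R)) : measurable A ->
  std_gaussian d [set t : d.-tuple (measurableTypeR R) | A (tnth t i)] =
  normal_prob (0 : R) 1 A.
Proof.
move=> mA; pose B j := if j == i then A else setT.
have -> : [set t : d.-tuple (measurableTypeR R) | A (tnth t i)] =
    [set t | forall j, B j (tnth t j)].
  apply/seteqP; split => t /= => [At j|/(_ i)]; rewrite /B ?eqxx//.
  by case: eqP => // ->.
rewrite std_gaussian_box; last by move=> j; rewrite /B; case: ifP.
rewrite (bigD1 i)//= /B eqxx big1 ?mule1// => j /negbTE ->.
exact: probability_setT.
Qed.

Lemma ge0_integral_std_gaussian_tnth (R : realType) (d : nat) (i : 'I_d)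
    (g : measurableTypeR R -> \bar R) :
  measurable_fun setT g -> (forall x, (0 <= g x)%E) ->
  (\int[std_gaussian d]_t g (tnth t i) = \int[normal_prob (0 : R) 1]_x g x)%E.
Proof.
move=> mg g0.
have mi : measurable_fun setT
    (fun t : d.-tuple (measurableTypeR R) => tnth t i) by exact: measurable_tnth.
rewrite -(@eq_measure_integral _ _ _ _ _ (pushforward (std_gaussian d)
    (fun t : d.-tuple (measurableTypeR R) => tnth t i))).
  by rewrite (ge0_integral_pushforward mi).
by move=> A mA _; exact: std_gaussian_tnth.
Qed.

Lemma integrable_std_gaussian_tnth (R : realType) (d : nat) (i : 'I_d) :
  (std_gaussian d).-integrable setT
    (fun t : d.-tuple (measurableTypeR R) => (tnth t i)%:E).
Proof.
apply/integrableP; split; first by apply/measurable_EFinP; exact: measurable_tnth.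
rewrite (@ge0_integral_std_gaussian_tnth _ _ i (fun x => `|x%:E|%E))//.
  by have /integrableP[] := integrable_normal_id R.
by apply: measurableT_comp => //; exact/measurable_EFinP.
Qed.

Lemma std_gaussian_mean0 (R : realType) (d : nat) (i : 'I_d) :
  (\int[std_gaussian d]_t (tnth t i : R)%:E = 0)%E.
Proof.
rewrite -(normal_mean0 R).
have mi : measurable_fun setT
    (fun t : d.-tuple (measurableTypeR R) => tnth t i) by exact: measurable_tnth.
rewrite -[RHS](@eq_measure_integral _ _ _ _ _ (pushforward (std_gaussian d)
    (fun t : d.-tuple (measurableTypeR R) => tnth t i))).
  rewrite (integral_pushforward mi)//.
  exact: integrable_std_gaussian_tnth.
by move=> A mA _; exact: std_gaussian_tnth.
Qed.

Lemma integral_std_gaussian_affine (R : realType) (d : nat) (a : R)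
    (c : 'I_d -> R) :
  (\int[std_gaussian d]_t (a + \sum_i c i * tnth t i)%:E = a%:E)%E.
Proof.
have ic i : (std_gaussian d).-integrable setT
    (fun t : d.-tuple (measurableTypeR R) => (c i * tnth t i)%:E).
  by have := integrableZl measurableT (c i) (integrable_std_gaussian_tnth R d i).
under eq_integral do rewrite EFinD -sumEFin.
rewrite integralD//;
  [|exact: finite_measure_integrable_cst|exact: integrable_sum].
rewrite integral_sum// big1 => [|i _].
  by rewrite adde0 integral_cst// [X in (_ * X)%E]probability_setT mule1.
under eq_integral do rewrite EFinM.
rewrite integralZl//; last exact: integrable_std_gaussian_tnth.
by rewrite std_gaussian_mean0 mule0.
Qed.

Lemma integral_std_gaussian_quadratic_le (R : realType) (d : nat) (a b : R) :
  0 <= b ->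
  (\int[std_gaussian d]_t (a + b * \sum_(i < d) tnth t i ^+ 2)%:E <=
    (a + b * d%:R)%:E)%E.
Proof.
move=> b0.
have mx : measurable_fun setT (fun x : measurableTypeR R => (x ^+ 2)%:E).
  by apply/measurable_EFinP; exact: measurable_funX.
have mi (i : 'I_d) : measurable_fun setT
    (fun t : d.-tuple (measurableTypeR R) => (tnth t i ^+ 2)%:E).
  by apply: (measurableT_comp mx); exact: measurable_tnth.
have ii (i : 'I_d) : (std_gaussian d).-integrable setT
    (fun t : d.-tuple (measurableTypeR R) => (tnth t i ^+ 2)%:E).
  apply/integrableP; split => //.
  under eq_integral do rewrite gee0_abs ?lee_fin ?sqr_ge0//.
  rewrite (@ge0_integral_std_gaussian_tnth _ _ i (fun x => (x ^+ 2)%:E))//.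
    by rewrite (le_lt_trans (normal_second_moment_le1 R)) ?ltry.
  by move=> x; rewrite lee_fin sqr_ge0.
under eq_integral do rewrite EFinD EFinM -sumEFin.
rewrite integralD//; [|exact: finite_measure_integrable_cst|
  by apply: integrableZl => //; exact: integrable_sum].
rewrite integral_cst// [X in (_ * X)%E]probability_setT mule1 EFinD leeD2l//.
rewrite integralZl//; last exact: integrable_sum.
rewrite integral_sum// EFinM lee_wpmul2l ?lee_fin//.
rewrite -[d in d%:R](card_ord d) -sumr_const -sumEFin; apply: lee_sum => i _.
rewrite (@ge0_integral_std_gaussian_tnth _ _ i (fun x => (x ^+ 2)%:E))//.
  exact: normal_second_moment_le1.
by move=> x; rewrite lee_fin sqr_ge0.
Qed.

(** * Euclidean norm and inner product *)

Lemma norm2_ge0 (R : realType) (m n : nat) (A : 'M[R]_(m, n)) : 0 <= norm2 A.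
Proof. exact: sqrtr_ge0. Qed.

Lemma norm2_sqr (R : realType) (d : nat) (v : 'cV[R]_d) :
  norm2 v ^+ 2 = \sum_i v i 0 ^+ 2.
Proof.
rewrite /norm2 sqr_sqrtr; first by apply: eq_bigr => i _; rewrite big_ord1.
by apply: sumr_ge0 => i _; apply: sumr_ge0 => j _; exact: sqr_ge0.
Qed.

Lemma norm2_sqr_dotv (R : realType) (d : nat) (v : 'cV[R]_d) :
  norm2 v ^+ 2 = dotv v v.
Proof. by rewrite norm2_sqr. Qed.

Lemma norm2_eq0 (R : realType) (d : nat) (v : 'cV[R]_d) : norm2 v = 0 -> v = 0.
Proof.
move=> v0; apply/matrixP => i j; rewrite ord1 mxE; apply/eqP.
rewrite -sqrf_eq0; have := norm2_sqr _ _ v; rewrite v0 expr0n/= => /esym/eqP.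
by rewrite psumr_eq0 => [/allP/(_ i (mem_index_enum _))|k _]; rewrite ?sqr_ge0.
Qed.

Lemma dotv_mxE (R : realType) (d : nat) (u v : 'cV[R]_d) :
  dotv u v = (u^T *m v) 0 0.
Proof. by rewrite mxE; apply: eq_bigr => i _; rewrite mxE. Qed.

Lemma dotvBl (R : realType) (d : nat) (u v w : 'cV[R]_d) :
  dotv (u - v) w = dotv u w - dotv v w.
Proof. by rewrite !dotv_mxE linearB mulmxBl !mxE. Qed.

Lemma dotvZr (R : realType) (d : nat) (a : R) (u v : 'cV[R]_d) :
  dotv u (a *: v) = a * dotv u v.
Proof. by rewrite !dotv_mxE -scalemxAr mxE. Qed.

(** Cauchy-Schwarz, by expanding the squared norm of [norm2 v *: u - norm2 u *: v]. *)
Lemma dotv_le_norm2 (R : realType) (d : nat) (u v : 'cV[R]_d) :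
  dotv u v <= norm2 u * norm2 v.
Proof.
have [u0|u_neq0] := eqVneq (norm2 u) 0.
  by rewrite u0 mul0r (norm2_eq0 _ _ _ u0) /dotv big1// => i _; rewrite mxE mul0r.
have [v0|v_neq0] := eqVneq (norm2 v) 0.
  by rewrite v0 mulr0 (norm2_eq0 _ _ _ v0) /dotv big1// => i _; rewrite mxE mulr0.
have uv0 : 0 < norm2 u * norm2 v by rewrite mulr_gt0// lt0r ?u_neq0 ?v_neq0 norm2_ge0.
rewrite -(ler_pM2l uv0).
have : 0 <= \sum_i (norm2 v * u i 0 - norm2 u * v i 0) ^+ 2.
  by apply: sumr_ge0 => i _; exact: sqr_ge0.
have -> : \sum_i (norm2 v * u i 0 - norm2 u * v i 0) ^+ 2 =
    norm2 v ^+ 2 * (\sum_i u i 0 ^+ 2) + norm2 u ^+ 2 * (\sum_i v i 0 ^+ 2)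
    - 2 * (norm2 u * norm2 v) * dotv u v.
  rewrite /dotv !mulr_sumr -big_split -sumrB/=; apply: eq_bigr => i _; ring.
rewrite -!norm2_sqr; set a := norm2 u; set b := norm2 v; nra.
Qed.

(** * Consequences of smoothness and strong convexity *)

(** The all-ones column is at positive distance from [0] once [d > 0]. This supplies the signs of
    [L] and [gamma]. *)
Lemma lipschitz_const_ge0 (R : realType) (d m n : nat)
    (F : 'cV[R]_d -> 'M[R]_(m, n)) (c : R) :
  (0 < d)%N ->
  (forall x y, norm2 (F x - F y) <= c * norm2 (x - y)) -> 0 <= c.
Proof.
move=> d0 /(_ (const_mx 1) 0); rewrite subr0 => /(le_trans (norm2_ge0 _ _ _ _)).
rewrite pmulr_lge0// lt0r norm2_ge0 andbT -(sqrf_eq0 (norm2 _)) norm2_sqr.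
under eq_bigr do rewrite mxE expr1n.
by rewrite sumr_const card_ord pnatr_eq0 -lt0n.
Qed.

(* The first-order convexity inequality at [x] rather than at [y] replaces the
   integral form of Taylor's theorem, at the cost of the constant [L] instead
   of [L / 2]. *)
Lemma smooth_convex_le (R : realType) (d : nat) (L sigma : R)
    (f : 'cV[R]_d -> R) (x y : 'cV[R]_d) :
  0 <= sigma -> smooth L f -> strongly_convex sigma f ->
  f x - f y <= dotv (grad f y) (x - y) + L * norm2 (x - y) ^+ 2.
Proof.
move=> sigma0 f_smooth f_conv.
have le1 : f x - f y <= dotv (grad f x) (x - y).
  have := f_conv y x; have : 0 <= sigma / 2 * norm2 (y - x) ^+ 2.
    by rewrite mulr_ge0 ?divr_ge0 ?sqr_ge0.
  by rewrite -(opprB x y) -scaleN1r dotvZr; lra.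
apply: le_trans le1 _; rewrite -lerBlDl -dotvBl.
apply: le_trans (dotv_le_norm2 _ _ _ _) _.
by rewrite expr2 mulrA ler_wpM2r ?norm2_ge0.
Qed.

(** A gradient step of length [t] from [y] changes [f] by at most [t * (L * t - 1) * norm2 g ^+ 2],
    which for small [t] contradicts minimality unless [g = 0]. *)
Lemma grad_min_eq0 (R : realType) (d : nat) (L sigma : R)
    (f : 'cV[R]_d -> R) (y : 'cV[R]_d) :
  0 <= sigma -> smooth L f -> strongly_convex sigma f ->
  (forall x, f y <= f x) -> grad f y = 0.
Proof.
move=> sigma0 f_smooth f_conv ymin; apply: norm2_eq0; apply/eqP.
rewrite -sqrf_eq0 eq_le sqr_ge0 andbT.
(* This [t] ensures [L * t <= 1 / 2]; the absolute value keeps it positive for either sign of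
   [L]. *)
set g := grad f y; pose t : R := (2 * (1 + `|L|))^-1.
have L1 : 0 < 2 * (1 + `|L|) :> R by rewrite mulr_gt0// ltr_wpDr.
have t0 : 0 < t by rewrite invr_gt0.
have Lt : L * t <= 2^-1.
  rewrite ler_pdivrMr// mulrA mulVf ?pnatr_eq0// mul1r.
  by have := ler_norm L; lra.
have := smooth_convex_le _ _ _ _ _ (y - t *: g) y sigma0 f_smooth f_conv.
rewrite -/g (_ : y - t *: g - y = (- t) *: g); last by rewrite addrAC subrr add0r scaleNr.
rewrite norm2_sqr_dotv !dotvZr.
have -> : dotv (- t *: g) g = - t * dotv g g.
  by rewrite /dotv mulr_sumr; apply: eq_bigr => i _; rewrite mxE mulrA.
rewrite -norm2_sqr_dotv; have := ymin (y - t *: g).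
have := sqr_ge0 (norm2 g); set G := norm2 g ^+ 2 => G0 fy.
have : 0 <= t * G * (L * t - 1) -> G <= 0; last by move=> h h'; apply: h; lra.
by rewrite -mulrA pmulr_rge0//; nra.
Qed.

(** * Matrix square root *)

(** [xget] returns a member of the set or its default [0]; the bound in [norm2_sqrtmx_le] holds in
    both cases. *)
Lemma sqrtmx_sqr (R : realType) (d : nat) (A : 'M[R]_d) :
  sqrtmx A = 0 \/ (sqrtmx A)^T = sqrtmx A /\ sqrtmx A *m sqrtmx A = A.
Proof.
rewrite /sqrtmx; case: xgetP => [B _ [[BT _] BB]|_]; [by right|by left].
Qed.

(** For a symmetric root [S] of [A], the squared norm of [S *m v] is [dotv v (A *m v)]. *)
Lemma norm2_sqrtmx_le (R : realType) (d : nat) (b : R) (A : 'M[R]_d)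
    (v : 'cV[R]_d) : 0 <= b ->
  loewner_le A b%:M -> norm2 (sqrtmx A *m v) ^+ 2 <= b * norm2 v ^+ 2.
Proof.
move=> b0 [_ /(_ v) Ab]; have [->|[ST SS]] := sqrtmx_sqr _ _ A.
  rewrite mul0mx {1}norm2_sqr big1 => [|i _]; first by rewrite mulr_ge0 ?exprn_ge0 ?norm2_ge0.
  by rewrite mxE expr0n.
have SvSv : dotv (sqrtmx A *m v) (sqrtmx A *m v) = dotv v (A *m v).
  by rewrite !dotv_mxE trmx_mul ST -mulmxA (mulmxA _ _ v) SS.
rewrite !norm2_sqr_dotv -subr_ge0 SvSv; move: Ab.
by rewrite !dotv_mxE mulmxBl mulmxBr mul_scalar_mx -scalemxAr !mxE.
Qed.

(** * Comparison of objective values and the final bounds *)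

Lemma gap_le_of_Qfun_le (R : realType) (d : nat) (alpha tau L sigma : R)
    (f : 'cV[R]_d -> R) (x y : 'cV[R]_d) (Sigma : 'M[R]_d) :
  0 <= sigma -> 0 <= L -> 0 < tau -> smooth L f -> strongly_convex sigma f ->
  loewner_le Sigma (tau^-1)%:M -> grad f y = 0 ->
  (Qfun f alpha x Sigma <= Qfun f alpha y Sigma)%E ->
  f x - f y <= d%:R * L * alpha ^+ 2 / tau.
Proof.
move=> sigma0 L0 tau0 f_smooth f_conv Sigma_le gy0.
rewrite /Qfun !unlock leeD2rE// => Exy.
(* Moving [S] onto the gradient makes the first-order term a linear form in the Gaussian
   coordinates, with coefficients [alpha * g i 0] and mean zero. *)
pose S := sqrtmx Sigma; pose g := S^T *m grad f x.
have lower : ((f x)%:E <= \int[std_gaussian d]_t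
    (f (x + alpha *: (S *m col_of_tuple t)))%:E)%E.
  rewrite -[leLHS](integral_std_gaussian_affine _ _ _ (fun i => alpha * g i 0)).
  apply: le_integral_pointwise => t; rewrite lee_fin -lerBrDl.
  have := f_conv (x + alpha *: (S *m col_of_tuple t)) x.
  rewrite addrAC subrr add0r dotvZr; apply: le_trans.
  have -> : dotv (grad f x) (S *m col_of_tuple t) = \sum_i g i 0 * tnth t i.
    transitivity (dotv g (col_of_tuple t)).
      by rewrite !dotv_mxE trmx_mul trmxK mulmxA.
    by apply: eq_bigr => i _; rewrite [col_of_tuple _ _ _]mxE.
  under eq_bigr do rewrite -mulrA.
  by rewrite -mulr_sumr lerDl mulr_ge0 ?divr_ge0 ?exprn_ge0 ?norm2_ge0.
have upper : (\int[std_gaussian d]_t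
    (f (y + alpha *: (S *m col_of_tuple t)))%:E <=
    (f y + L * alpha ^+ 2 / tau * d%:R)%:E)%E.
  have c0 : 0 <= L * alpha ^+ 2 / tau.
    by apply: divr_ge0; [exact: mulr_ge0 L0 (sqr_ge0 _)|exact: ltW].
  apply: le_trans (integral_std_gaussian_quadratic_le _ _ (f y) _ c0).
  apply: le_integral_pointwise => t; rewrite lee_fin -lerBlDl.
  set w := col_of_tuple t.
  have := smooth_convex_le _ _ _ _ _ (y + alpha *: (S *m w)) y sigma0 f_smooth f_conv.
  move=> /le_trans; apply; rewrite gy0 addrAC subrr add0r.
  rewrite {1}/dotv big1 ?add0r => [|i _]; last by rewrite mxE mul0r.
  have -> : norm2 (alpha *: (S *m w)) ^+ 2 = alpha ^+ 2 * norm2 (S *m w) ^+ 2.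
    by rewrite !norm2_sqr mulr_sumr; apply: eq_bigr => i _; rewrite mxE exprMn.
  have -> : \sum_i tnth t i ^+ 2 = norm2 w ^+ 2.
    by rewrite norm2_sqr; apply: eq_bigr => i _; rewrite mxE.
  rewrite mulrA -[leRHS]mulrA (ler_wpM2l (mulr_ge0 L0 (sqr_ge0 _)))//.
  by apply: norm2_sqrtmx_le => //; rewrite invr_ge0 ltW.
have := le_trans lower (le_trans Exy upper); rewrite lee_fin.
by rewrite (_ : d%:R * L * alpha ^+ 2 / tau = L * alpha ^+ 2 / tau * d%:R); [lra|ring].
Qed.
Theorem theorem3 (R : realType) (d : nat) (alpha tau zeta L sigma gamma : R)
    (f : 'cV[R]_d -> R) (mu_star mu_hat : 'cV[R]_d) (Sigma_hat : 'M[R]_d)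
    (alpha_gt0 : 0 < alpha) (tau_gt0 : 0 < tau) (tau_le_zeta : tau <= zeta)
    (sigma_gt0 : 0 < sigma)
    (f_diff2 : twice_differentiable f) (f_smooth : smooth L f)
    (f_sconvex : strongly_convex sigma f)
    (f_hess : lipschitz_hessian gamma f)
    (Sigma_hatS : Sset tau zeta Sigma_hat)
    (mu_hat_min : forall (mu : 'cV[R]_d) (Sigma : 'M[R]_d),
       Sset tau zeta Sigma ->
       (Qfun f alpha mu_hat Sigma_hat <= Qfun f alpha mu Sigma)%E)
    (mu_star_min : forall mu : 'cV[R]_d, f mu_star <= f mu) :
  f mu_hat - f mu_star <=
    d%:R * L * alpha ^+ 2 / tau
    + gamma * alpha ^+ 3 * ((d ^ 2 + 2 * d)%:R `^ (3 / 4))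
      / (3 * tau `^ (3 / 2))
    + d%:R * alpha ^+ 2 / 2 * (tau^-1 - zeta^-1)
  /\
  norm2 (mu_star - mu_hat) ^+ 2 <=
    2 * d%:R * L * alpha ^+ 2 / (sigma * tau)
    + 2 * gamma * alpha ^+ 3 * ((d ^ 2 + 2 * d)%:R `^ (3 / 4))
      / (3 * sigma * tau `^ (3 / 2))
    + d%:R * alpha ^+ 2 / sigma * (tau^-1 - zeta^-1).

Proof.
have zeta_gt0 : 0 < zeta by exact: lt_le_trans tau_gt0 tau_le_zeta.
have inv_ge0 : 0 <= tau^-1 - zeta^-1 by rewrite subr_ge0 lef_pV2.
have sigma_ge0 := ltW sigma_gt0.
have g0 := grad_min_eq0 _ _ _ _ _ _ sigma_ge0 f_smooth f_sconvex mu_star_min.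
set B1 := d%:R * L * alpha ^+ 2 / tau.
set P := (d ^ 2 + 2 * d)%:R `^ (3 / 4).
have L_bound : f mu_hat - f mu_star <= B1.
  (* In dimension 0 the Lipschitz condition does not fix the sign of [L], but all columns coincide
     and both sides vanish. *)
  have [d0|d_gt0] := posnP d.
    rewrite /B1 (_ : mu_hat = mu_star) ?subrr ?d0 ?mul0r//.
    by apply/matrixP => i; have := ltn_ord i; rewrite {2}d0.
  apply: (gap_le_of_Qfun_le _ _ _ _ _ _ _ _ _ _ sigma_ge0 _ tau_gt0 f_smooth
    f_sconvex _ g0 (mu_hat_min _ _ Sigma_hatS)).
  - exact: (lipschitz_const_ge0 _ _ _ _ _ _ d_gt0 f_smooth).
  - by case: Sigma_hatS => _ _; exact.
(* The product is treated as a whole: for [d = 0] the sign of [gamma] is undetermined but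
   [P = 0]. *)
have gammaP : 0 <= gamma * P.
  have [d0|d_gt0] := posnP d.
    by rewrite /P d0 powR0 ?mulr0//; lra.
  by rewrite mulr_ge0 ?powR_ge0//; exact: (lipschitz_const_ge0 _ _ _ _ _ _ d_gt0 f_hess).
have tau32 : 0 < tau `^ (3 / 2) by exact: powR_gt0.
have gamma_ge0 : 0 <= gamma * alpha ^+ 3 * P / (3 * tau `^ (3 / 2)).
  rewrite [gamma * _ * _]mulrAC; apply: divr_ge0; last by rewrite mulr_ge0// ltW.
  by rewrite mulr_ge0// exprn_ge0// ltW.
have zeta_ge0 : 0 <= d%:R * alpha ^+ 2 / 2 * (tau^-1 - zeta^-1).
  by rewrite mulr_ge0// divr_ge0// mulr_ge0// sqr_ge0.
split; first by lra.
(* With zero gradient at [mu_star], strong convexity bounds [sigma / 2] times the squared distance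
   by the gap in [f]; scaling by [sigma / 2] turns the second bound into the first. *)
have := f_sconvex mu_hat mu_star; rewrite g0 {1}/dotv big1 ?add0r; last first.
  by move=> i _; rewrite mxE mul0r.
have -> : norm2 (mu_star - mu_hat) ^+ 2 = norm2 (mu_hat - mu_star) ^+ 2.
  by rewrite !norm2_sqr; apply: eq_bigr => i _; rewrite !mxE -sqrrN opprB.
set N := norm2 _ ^+ 2 => N_le.
rewrite -(ler_pM2l (_ : 0 < sigma / 2)) ?divr_gt0//.
have -> : sigma / 2 * (2 * d%:R * L * alpha ^+ 2 / (sigma * tau)
    + 2 * gamma * alpha ^+ 3 * P / (3 * sigma * tau `^ (3 / 2))
    + d%:R * alpha ^+ 2 / sigma * (tau^-1 - zeta^-1)) =
    B1 + gamma * alpha ^+ 3 * P / (3 * tau `^ (3 / 2))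
    + d%:R * alpha ^+ 2 / 2 * (tau^-1 - zeta^-1).
  by rewrite /B1; field; rewrite !gt_eqF.
lra.
Qed.
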